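(* Let $(J,W)$ be a graphon and let $\varepsilon>0$. (a) Let $S$ be a finite average $\varepsilon$-net in the pseudometric space $(J,r_{W\circ W})$. Then the Voronoi cells of $S$ (with ties broken arbitrarily so as to obtain a partition) form a weak regularity partition with error at most $8\sqrt{\varepsilon}$. (b) Let $\mathcal{P}=\{J_1,\dots,J_k\}$ be a weak regularity partition of $(J,W)$ with error $\varepsilon$. Then there are points $v_i\in J_i$ ($i=1,\dots,k$) such that $S=\{v_1,\dots,v_k\}$ is an average $(4\varepsilon)$-net in $(J,r_{W\circ W})$.
   Context: A graphon is a pair $(J,W)$ with $J$ a standard probability space (measure $\pi$) and $W:J\times J\to[0,1]$ symmetric measurable. $(W\circ W)(x,y)=\int_J W(x,z)W(z,y)\,dz$ and $r_{W\circ W}(a,b)=\int_J|(W\circ W)(a,x)-(W\circ W)(b,x)|\,dx$. A finite set $S\subseteq J$ is an average $\varepsilon$-net for a distance $d$ if $\int_J d(x,S)\,d\pi(x)\le\varepsilon$, where $d(x,S)=\min_{s\in S}d(x,s)$. The Voronoi cell of $S$ with center $s\in S$ is the set of $x\in J$ with $d(x,s)\le d(x,y)$ for all $y\in S$. For a partition $\mathcal{P}$ of $J$ into measurable sets of positive measure, with $S(x)$ the class containing $x$, set $W_{\mathcal{P}}(x,y)=\frac{1}{\pi(S(x))\pi(S(y))}\int_{S(x)\times S(y)}W$. The cut norm is $\|U\|_\square=\sup_{S,T\subseteq J}|\int_{S\times T}U(x,y)\,dx\,dy|$ over measurable $S,T$. $\mathcal{P}$ is a weak regularity partition with error $\varepsilon$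 if $\|W-W_{\mathcal{P}}\|_\square\le\varepsilon$. *)

(* Defs.v *)
From HB Require Import structures.
From mathcomp Require Import all_boot all_order all_algebra finmap.
From mathcomp Require Import all_classical all_reals all_analysis.

Set Implicit Arguments.
Unset Strict Implicit.
Unset Printing Implicit Defensive.

Import Order.TTheory GRing.Theory Num.Theory.
Import numFieldNormedType.Exports.

Local Open Scope classical_set_scope.
Local Open Scope ring_scope.

Section Graphons.
Context (R : realType) (d : measure_display) (J : measurableType d).
Implicit Types (mu : probability J R) (U W : J -> J -> R) (S : {fset J}).

(* [phi] is an isomorphism mod 0 from J onto the real line with the law of
   [phi]: it is injective on a set of full measure and it maps measurable sets
   to sets that are Borel up to null sets.  Both standard Borel spaces and
   their completions (Lebesgue-Rokhlin spaces) satisfy this. *)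
Definition standard_probability_space mu : Prop :=
  exists (phi : J -> R) (J0 : set J),
    [/\ measurable_fun [set: J] phi,
        measurable J0 /\ mu J0 = 1%E,
        {in J0 &, injective phi} &
        forall A : set J, measurable A ->
          exists B : set R, [/\ measurable B, B `<=` phi @` (A `&` J0) &
                               mu (A `\` phi @^-1` B) = 0%E]].

Definition graphon mu W : Prop :=
  [/\ standard_probability_space mu,
      measurable_fun [set: J * J] (fun z => W z.1 z.2),
      (forall x y, W x y = W y x) &
      (forall x y, 0 <= W x y <= 1)].

Definition graphon_comp mu W : J -> J -> R :=
  fun x y => \int[mu]_z (W x z * W z y).

Definition neighborhood_dist mu U : J -> J -> R :=
  fun a b => \int[mu]_x `|U a x - U b x|.

Definition similarity_dist mu W : J -> J -> R :=
  neighborhood_dist mu (graphon_comp mu W).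

(* Extended-real valued, so that the distance to the empty set is +oo and the
   empty set is never an average net. *)
Definition dist_to (r : J -> J -> R) S (x : J) : \bar R :=
  \big[mine/+oo%E]_(s <- S) (r x s)%:E.

Definition average_net mu (r : J -> J -> R) (eps : R) S : Prop :=
  (\int[mu]_x dist_to r S x <= eps%:E)%E.

Definition voronoi_cell (r : J -> J -> R) S (s : J) : set J :=
  [set x | forall y, y \in S -> r x s <= r x y].

Definition measurable_partition (I : finType) (P : I -> set J) : Prop :=
  [/\ forall i, measurable (P i),
      trivIset [set: I] P &
      \bigcup_i P i = [set: J]].

(* Breaking ties: every point is assigned to exactly one of the centers whose
   Voronoi cell contains it.  The resulting cells may be null, or even empty. *)
Definition voronoi_partition (r : J -> J -> R) S (V : S -> set J) : Prop :=
  measurable_partition V /\ forall s : S, V s `<=` voronoi_cell r S (val s).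

(* For a partition, the only class containing [x]. *)
Definition class_of (I : finType) (P : I -> set J) (x : J) : set J :=
  \bigcup_(i in [set i | P i x]) P i.

(* By the convention 0^-1 = 0, this is 0 when [x] or [y] lies in a null class;
   such pairs form a null set, so they do not affect the cut norm. *)
Definition stepping mu W (I : finType) (P : I -> set J) : J -> J -> R :=
  fun x y =>
    (fine (mu (class_of P x)) * fine (mu (class_of P y)))^-1 *
    \int[(mu \x mu)%E]_(z in class_of P x `*` class_of P y) W z.1 z.2.

Definition cut_norm mu U : \bar R :=
  ereal_sup [set t | exists A B : set J, [/\ measurable A, measurable B &
    t = `|\int[(mu \x mu)%E]_(z in A `*` B) (U z.1 z.2)%:E|%E]].

(* Positivity of the measures of the classes is not part of this definition:
   Voronoi cells can be null.  It is assumed separately where needed. *)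
Definition weak_regularity_partition mu W (eps : R)
    (I : finType) (P : I -> set J) : Prop :=
  measurable_partition P /\
  (cut_norm mu (fun x y => (W x y - stepping mu W P x y)%R) <= eps%:E)%E.

End Graphons.

(* Main.v *)
(* (a) Write [f = f_P + g] for [f] with values in [0, 1], where [f_P] averages
   [f] over the cells, and similarly [h = h_P + k].  As [<f, W_P h> =
   <f_P, W h_P>], one has [<f, (W - W_P) h> = <f, W k> + <W g, h_P>], which is
   at most [|W k|_1 + |W g|_1].  By symmetry [|W g|_2^2 = <g, (W o W) g>], and
   since [g] averages to 0 on each cell, [(W o W)(x, .)] may be replaced by
   its difference with [(W o W)(s, .)], [s] being the center of the cell of
   [x].  This bounds [|W g|_2^2] by the average distance to the net, so the
   error is in fact at most [2 sqrt eps].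

   (b) Put [U = W - W_P] and [F a = |(U o W)(a, .)|_1].  Testing [U] against
   [[0, 1]]-valued functions instead of sets does not increase the cut norm, so
   [F] has integral at most [2 eps].  If [a] and [b] lie in the same class
   then [W_P(a, .) = W_P(b, .)], hence [r(a, b) <= F a + F b]; choose [v_i] in
   [J_i] with [F (v_i)] at most the mean of [F] on [J_i]. *)
Require Import Defs.
From mathcomp Require Import all_boot all_order all_algebra finmap.
From mathcomp Require Import all_classical all_reals all_analysis.
From mathcomp Require Import measurable_realfun ring lra.

Import Order.TTheory GRing.Theory Num.Theory.

Local Open Scope classical_set_scope.
Local Open Scope ring_scope.

Set Implicit Arguments.
Unset Strict Implicit.
Unset Printing Implicit Defensive.

(** * Bounded measurable functions *)

(** This class is closed under algebra, composition and integration over a parameter, and its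
    members are integrable for every probability. All side conditions of linearity and Fubini thus
    reduce to it. *)
Definition bounded_measurable (R : realType) d (T : measurableType d)
    (f : T -> R) : Prop :=
  measurable_fun [set: T] f /\ exists M, forall x, `|f x| <= M.

Section BoundedMeasurable.
Context (R : realType) d (T : measurableType d).
Implicit Types (f g : T -> R).
Local Notation bm := bounded_measurable.

Lemma bm_cst (c : R) : bm (fun _ : T => c).
Proof. by split; [exact: measurable_cst | exists `|c|]. Qed.

Lemma bmD f g : bm f -> bm g -> bm (fun x => f x + g x).
Proof.
move=> [mf [M hM]] [mg [N hN]]; split; first exact: measurable_funD.
by exists (M + N) => x; rewrite (le_trans (ler_normD _ _))// lerD.
Qed.

Lemma bmM f g : bm f -> bm g -> bm (fun x => f x * g x).
Proof.
move=> [mf [M hM]] [mg [N hN]]; split; first exact: measurable_funM.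
by exists (M * N) => x; rewrite normrM ler_pM.
Qed.

Lemma bmN f : bm f -> bm (fun x => - f x).
Proof.
move=> [mf [M hM]]; split; first exact: measurableT_comp.
by exists M => x; rewrite normrN.
Qed.

Lemma bmB f g : bm f -> bm g -> bm (fun x => f x - g x).
Proof. by move=> bf bg; apply: bmD => //; exact: bmN. Qed.

Lemma bm_norm f : bm f -> bm (fun x => `|f x|).
Proof.
move=> [mf [M hM]]; split; first exact: measurableT_comp.
by exists M => x; rewrite normr_id.
Qed.

Lemma bmX f n : bm f -> bm (fun x => f x ^+ n).
Proof.
move=> bf; elim: n => [|n ih]; first exact: bm_cst.
by under eq_fun do rewrite exprS; exact: bmM.
Qed.

Lemma bm_indic (A : set T) : measurable A -> bm (\1_A : T -> R).
Proof.
move=> mA; split; first exact: measurable_indic.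
by exists 1 => x; rewrite indicE ger0_norm// lern1 leq_b1.
Qed.

Lemma bm_sum (I : Type) (s : seq I) (F : I -> T -> R) :
  (forall i, bm (F i)) -> bm (fun x => \sum_(i <- s) F i x).
Proof.
move=> bF; elim: s => [|i s ih].
  by under eq_fun do rewrite big_nil; exact: bm_cst.
by under eq_fun do rewrite big_cons; exact: bmD.
Qed.

End BoundedMeasurable.

Section BoundedMeasurableComp.
Context (R : realType) d d' d'' (T : measurableType d) (T1 : measurableType d')
  (T2 : measurableType d'').
Local Notation bm := bounded_measurable.

Lemma bm_comp (f : T1 -> R) (p : T -> T1) :
  bm f -> measurable_fun [set: T] p -> bm (fun t => f (p t)).
Proof.
move=> [mf [M hM]] mp; split; first exact: measurableT_comp mf mp.
by exists M => t.
Qed.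

Lemma bm_comp2 (f : T1 -> T2 -> R) (p : T -> T1) (q : T -> T2) :
  bm (fun z => f z.1 z.2) -> measurable_fun [set: T] p ->
  measurable_fun [set: T] q -> bm (fun t => f (p t) (q t)).
Proof.
move=> [mf [M hM]] mp mq; split; last by exists M => t; exact: (hM (p t, q t)).
by apply: (measurableT_comp mf (measurable_fun_pair mp mq)).
Qed.

End BoundedMeasurableComp.

Section BoundedIntegral.
Context (R : realType) d (T : measurableType d) (mu : probability T R).
Implicit Types (f g : T -> R).
Local Notation bm := bounded_measurable.

Lemma bm_integrable f : bm f -> mu.-integrable [set: T] (EFin \o f).
Proof.
move=> [mf [M hM]]; apply: measurable_bounded_integrable => //.
  by rewrite [X in (X < _)%E]probability_setT ltry.
exists M; split; first by rewrite num_real.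
by move=> N MN x _ /=; apply: le_trans (hM x) (ltW MN).
Qed.

Lemma bm_integralE f : bm f -> (\int[mu]_x (f x)%:E = (\int[mu]_x f x)%:E)%E.
Proof.
move=> bf; rewrite /Rintegral fineK//.
by apply: integrable_fin_num => //; exact: bm_integrable.
Qed.

Lemma RintegralT_cst (c : R) : \int[mu]_x c = c.
Proof. by rewrite Rintegral_cst// [X in fine X]probability_setT mulr1. Qed.

Lemma bm_intD f g : bm f -> bm g ->
  \int[mu]_x (f x + g x) = \int[mu]_x f x + \int[mu]_x g x.
Proof. by move=> bf bg; rewrite RintegralD//; exact: bm_integrable. Qed.

Lemma bm_intB f g : bm f -> bm g ->
  \int[mu]_x (f x - g x) = \int[mu]_x f x - \int[mu]_x g x.
Proof. by move=> bf bg; rewrite RintegralB//; exact: bm_integrable. Qed.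

Lemma bm_intZl f c : bm f -> \int[mu]_x (c * f x) = c * \int[mu]_x f x.
Proof. by move=> bf; rewrite RintegralZl//; exact: bm_integrable. Qed.

Lemma bm_intZr f c : bm f -> \int[mu]_x (f x * c) = (\int[mu]_x f x) * c.
Proof. by move=> bf; rewrite RintegralZr//; exact: bm_integrable. Qed.

Lemma bm_int_sum (I : Type) (s : seq I) (F : I -> T -> R) :
  (forall i, bm (F i)) ->
  \int[mu]_x (\sum_(i <- s) F i x) = \sum_(i <- s) \int[mu]_x F i x.
Proof.
move=> bF; elim: s => [|i s ih].
  rewrite big_nil; under eq_Rintegral do rewrite big_nil.
  exact: RintegralT_cst.
rewrite big_cons -ih -bm_intD//; last exact: bm_sum.
by apply: eq_Rintegral => x _; rewrite big_cons.
Qed.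

Lemma bm_le_int f g : bm f -> bm g -> (forall x, f x <= g x) ->
  \int[mu]_x f x <= \int[mu]_x g x.
Proof. by move=> bf bg fg; apply: le_Rintegral => //; exact: bm_integrable. Qed.

Lemma bm_le_norm_int f : bm f -> `|\int[mu]_x f x| <= \int[mu]_x `|f x|.
Proof. by move=> bf; apply: le_normr_Rintegral => //; exact: bm_integrable. Qed.

Lemma Rintegral_indic (A : set T) :
  measurable A -> \int[mu]_x \1_A x = fine (mu A).
Proof. by move=> mA; rewrite /Rintegral integral_indic// setIT. Qed.

End BoundedIntegral.

(** * Parameter integrals and Fubini for bounded functions *)

Section BoundedFubini.
Context (R : realType) d d' (T1 : measurableType d) (T2 : measurableType d')
  (m1 : probability T1 R) (m2 : probability T2 R).
Local Notation bm := bounded_measurable.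

Lemma bm_param_int (f : T1 -> T2 -> R) :
  bm (fun z => f z.1 z.2) -> bm (fun x => \int[m2]_y f x y).
Proof.
move=> bf.
have bfx x : bm (f x).
  exact: (bm_comp2 bf (measurable_cst x) (@measurable_id _ _ setT)).
have [mf [M hM]] := bf; split; last first.
  exists M => x; apply: (le_trans (bm_le_norm_int m2 (bfx x))).
  rewrite -[leRHS](RintegralT_cst m2) bm_le_int//.
  - exact: bm_norm.
  - exact: bm_cst.
  - by move=> y; exact: (hM (x, y)).
(* Tonelli's measurability statement needs a nonnegative integrand. Adding the bound [M] gives one,
   and shifts the inner integral by exactly [M] because [m2] has total mass 1. *)
pose g z := ((f z.1 z.2 + M)%:E)%E.
have mg : measurable_fun setT g.
  by apply/measurable_EFinP; apply: measurable_funD => //; exact: measurable_cst.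
have g0 z : (0 <= g z)%E.
  by rewrite lee_fin -lerBlDr sub0r; have := hM z; rewrite ler_norml => /andP[].
have := @measurable_fun_fubini_tonelli_F _ _ _ _ _ m2 g mg g0.
have -> : fubini_F m2 g = fun x => ((\int[m2]_y f x y) + M)%:E.
  apply/funext => x; rewrite /fubini_F /g/= bm_integralE.
    by rewrite bm_intD ?RintegralT_cst//; exact: bm_cst.
  by apply: bmD => //; exact: bm_cst.
move=> /measurable_EFinP h.
rewrite (_ : (fun x => _) = fun x => ((\int[m2]_y f x y) + M) - M); last first.
  by apply/funext => x; rewrite addrK.
by apply: measurable_funB => //; exact: measurable_cst.
Qed.

Lemma bm_int_prod (f : T1 -> T2 -> R) : bm (fun z => f z.1 z.2) ->
  \int[(m1 \x m2)%E]_z f z.1 z.2 = \int[m1]_x \int[m2]_y f x y.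
Proof.
move=> bf; rewrite {1}/Rintegral -integral12_prod_meas1; last first.
  exact: (bm_integrable (m1 \x m2)%E bf).
congr fine; apply: eq_integral => x _; rewrite /fubini_F /= bm_integralE//.
exact: (bm_comp2 bf (measurable_cst x) (@measurable_id _ _ setT)).
Qed.

Lemma bm_Fubini (f : T1 -> T2 -> R) : bm (fun z => f z.1 z.2) ->
  \int[m1]_x \int[m2]_y f x y = \int[m2]_y \int[m1]_x f x y.
Proof.
move=> bf.
have bf' := bm_integrable (m1 \x m2)%E bf.
rewrite -bm_int_prod// /Rintegral -integral21_prod_meas1//.
congr fine; apply: eq_integral => y _; rewrite /fubini_G /= bm_integralE//.
exact: (bm_comp2 bf (@measurable_id _ _ setT) (measurable_cst y)).
Qed.

Lemma bm_int_rect (f : T1 -> T2 -> R) (A : set T1) (B : set T2) :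
  measurable A -> measurable B -> bm (fun z => f z.1 z.2) ->
  (\int[(m1 \x m2)%E]_(z in A `*` B) (f z.1 z.2)%:E =
   (\int[m1]_x \int[m2]_y (\1_A x * \1_B y * f x y))%:E)%E.
Proof.
move=> mA mB bf.
have bF : bm (fun z : T1 * T2 => \1_A z.1 * \1_B z.2 * f z.1 z.2).
  apply: bmM => //; apply: bmM.
    by apply: (@bm_comp _ _ _ _ _ \1_A); [exact: bm_indic|exact: measurable_fst].
  by apply: (@bm_comp _ _ _ _ _ \1_B); [exact: bm_indic|exact: measurable_snd].
rewrite -(@bm_int_prod (fun x y => \1_A x * \1_B y * f x y))//.
rewrite -bm_integralE// integral_mkcond; apply: eq_integral => -[x y] _ /=.
rewrite patchE in_setX/= !indicE.
by case: (x \in A); case: (y \in B); rewrite /= ?mul0r ?mulr0 ?mul0r ?mul1r.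
Qed.

End BoundedFubini.

(** * Automation for bounded measurability *)

Section MeasurableProj.
Context d d' d'' (T : measurableType d) (T1 : measurableType d')
  (T2 : measurableType d'').

Lemma measurable_fun_fst (q : T -> T1 * T2) :
  measurable_fun [set: T] q -> measurable_fun [set: T] (fun t => (q t).1).
Proof. exact: measurableT_comp. Qed.

Lemma measurable_fun_snd (q : T -> T1 * T2) :
  measurable_fun [set: T] q -> measurable_fun [set: T] (fun t => (q t).2).
Proof. exact: measurableT_comp. Qed.

End MeasurableProj.

Ltac measurable_proj :=
  solve [ exact: measurable_id | exact: measurable_cst
        | apply: measurable_fun_fst; measurable_proj
        | apply: measurable_fun_snd; measurable_proj ].

Ltac bm_hyp :=
  match goal with
  | H : bounded_measurable _ |- _ => apply: (bm_comp2 H); measurable_proj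
  | H : bounded_measurable _ |- _ => apply: (bm_comp H); measurable_proj
  | H : forall i, bounded_measurable _ |- _ =>
      apply: (bm_comp (H _)); measurable_proj
  end.

(* The dispatch is syntactic: unification up to unfolding would open [stepping]
   or [graphon_comp] instead of using the hypothesis about it. *)
Ltac bm_step :=
  cbv beta; first
  [ assumption
  | exact: bm_cst
  | lazymatch goal with
    | |- bounded_measurable (fun x => @?f x - @?g x) => apply: bmB
    | |- bounded_measurable (fun x => @?f x + @?g x) => apply: bmD
    | |- bounded_measurable (fun x => @?f x * @?g x) => apply: bmM
    | |- bounded_measurable (fun x => @?f x ^+ _) => apply: bmX
    | |- bounded_measurable (fun x => `|@?f x|) => apply: bm_norm
    | |- bounded_measurable (fun x => bigop.body _ _ (@?F x)) =>
        apply: bm_sum => ?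
    | |- bounded_measurable (fun x => Rintegral _ _ (@?F x)) =>
        apply: bm_param_int => /=
    | |- _ => bm_hyp
    end ].

Ltac bm := repeat bm_step.

(** * Cells of a partition *)

Section Graphon.
Context (R : realType) d (J : measurableType d) (mu : probability J R).
Variable W : J -> J -> R.
Hypothesis bW : bounded_measurable (fun z : J * J => W z.1 z.2).
Hypothesis symW : forall x y, W x y = W y x.

Local Notation bm2 f := (bounded_measurable (fun z : J * J => f z.1 z.2)).

Lemma bm_graphon_comp : bm2 (graphon_comp mu W).
Proof.
apply: (@bm_param_int _ _ _ _ _ mu (fun p z => W p.1 z * W z p.2)) => /=.
bm.
Qed.

Lemma bm_similarity_dist : bm2 (similarity_dist mu W).
Proof.
have bK := bm_graphon_comp.
apply: (@bm_param_int _ _ _ _ _ mu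
  (fun p z => `|graphon_comp mu W p.1 z - graphon_comp mu W p.2 z|)) => /=.
bm.
Qed.

(** The square is a product of an integral in [x] and one in [y]. Two uses of Fubini make [z] the
    innermost variable, and symmetry turns [W z x * W z y] into the integrand of [W \o W]. *)
Lemma int_sqr_comp (g : J -> R) : bounded_measurable g ->
  \int[mu]_z (\int[mu]_x (W z x * g x)) ^+ 2 =
  \int[mu]_x \int[mu]_y (g x * g y * graphon_comp mu W x y).
Proof.
move=> bg.
pose F z x y := W z x * g x * (W z y * g y).
transitivity (\int[mu]_z \int[mu]_x \int[mu]_y F z x y).
  apply: eq_Rintegral => z _; rewrite expr2 -bm_intZr; last by bm.
  apply: eq_Rintegral => x _; rewrite -bm_intZl//; bm.
rewrite (@bm_Fubini _ _ _ _ _ mu mu (fun z x => \int[mu]_y F z x y)); last first.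
  by rewrite /F; bm.
apply: eq_Rintegral => x _.
rewrite bm_Fubini; last by rewrite /F; bm.
apply: eq_Rintegral => y _.
rewrite /graphon_comp -bm_intZl; last by bm.
by apply: eq_Rintegral => z _; rewrite /F (symW z x); ring.
Qed.

Section Partition.
Context (I : finType) (V : I -> set J).
Hypothesis pV : measurable_partition V.

Lemma partition_ex x : exists i, V i x.
Proof.
by have [_ _ h] := pV; have : [set: J] x by []; rewrite -h => -[i _]; exists i.
Qed.

Lemma partition_uniq x i j : V i x -> V j x -> i = j.
Proof. by have [_ h _] := pV; move=> ix jx; apply: h => //; exists x. Qed.

(** Such sums encode the value of [F] at the class of [x]. Unlike a choice of the class, they are
    visibly measurable in [x]. *)
Lemma partition_sum (F : I -> R) x i : V i x -> \sum_j \1_(V j) x * F j = F i.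
Proof.
move=> ix; rewrite (bigD1 i)//= big1 ?addr0; last first.
  move=> j /eqP ji; rewrite indicE memNset ?mul0r// => jx.
  by apply: ji; apply: partition_uniq jx ix.
by rewrite indicE mem_set ?mul1r.
Qed.

Lemma bm_cell i : bounded_measurable (\1_(V i) : J -> R).
Proof. by have [h _ _] := pV; exact: bm_indic. Qed.

Lemma class_ofE x i : V i x -> class_of V x = V i.
Proof.
move=> ix; apply/seteqP; split => [y [j /= jx jy]|y iy].
  by rewrite (partition_uniq ix jx).
by exists i.
Qed.

Definition step_coef i j : R := (fine (mu (V i)) * fine (mu (V j)))^-1 *
  \int[mu]_x \int[mu]_y (\1_(V i) x * \1_(V j) y * W x y).

(** As a finite sum of products of indicators, the step function can be integrated term by term. *)
Lemma steppingE x y : stepping mu W V x y =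
  \sum_i \1_(V i) x * \sum_j \1_(V j) y * step_coef i j.
Proof.
have [i ix] := partition_ex x; have [j jy] := partition_ex y.
rewrite (partition_sum _ ix) (partition_sum _ jy).
have [mV _ _] := pV.
by rewrite /stepping (class_ofE ix) (class_ofE jy) /Rintegral bm_int_rect.
Qed.

Lemma bm_stepping : bm2 (stepping mu W V).
Proof.
have bV := bm_cell.
under eq_fun do rewrite steppingE.
by bm.
Qed.

Lemma int_sqr_le_dist (g : J -> R) (s : I -> J) :
  bounded_measurable g -> (forall x, `|g x| <= 1) ->
  (forall i, \int[mu]_x (\1_(V i) x * g x) = 0) ->
  \int[mu]_z (\int[mu]_x (W z x * g x)) ^+ 2 <=
  \int[mu]_x \sum_i \1_(V i) x * similarity_dist mu W x (s i).
Proof.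
move=> bg g1 g0; rewrite int_sqr_comp//.
have bK := bm_graphon_comp; have bV := bm_cell; have br := bm_similarity_dist.
set K := graphon_comp mu W in bK *.
(* [L] replaces the row of [K] at [x] by the row at the center of the cell of [x]. For fixed [y] it
   is constant in [x] on each cell, where [g] integrates to 0, so its contribution [L0] vanishes. *)
pose L x y := \sum_i \1_(V i) x * K (s i) y.
have bL : bm2 L by rewrite /L; bm.
have L0 : \int[mu]_x \int[mu]_y (g x * g y * L x y) = 0.
  transitivity (\int[mu]_x \sum_i (\1_(V i) x * g x) *
      \int[mu]_y (g y * K (s i) y)).
    apply: eq_Rintegral => x _; rewrite /L.
    transitivity (\sum_i \int[mu]_y (\1_(V i) x * g x * (g y * K (s i) y)));
      last by apply: eq_bigr => i _; rewrite bm_intZl//; bm.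
    rewrite -bm_int_sum; last by move=> i; bm.
    apply: eq_Rintegral => y _; rewrite mulr_sumr.
    by apply: eq_bigr => i _; ring.
  rewrite bm_int_sum; last by move=> i; bm.
  by rewrite big1// => i _; rewrite bm_intZr ?g0 ?mul0r//; bm.
(* Subtracting [L0] turns [K] into [K - L]; since [g] is bounded by 1, what remains is at most the
   integral of [|K - L|], which is the distance to the center. *)
rewrite -[leLHS]subr0 -[X in _ - X]L0 -bm_intB; [|by bm|by bm].
apply: bm_le_int; [by bm|by bm|].
move=> x; rewrite -bm_intB; [|by bm|by bm].
have [i ix] := partition_ex x.
rewrite (partition_sum (fun i => similarity_dist mu W x (s i)) ix).
apply: bm_le_int; [by bm|by bm|].
move=> y; rewrite /L (partition_sum (fun i => K (s i) y) ix) -mulrBr.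
apply: le_trans (ler_norm _) _.
rewrite !normrM -[leRHS]mul1r ler_wpM2r//.
by rewrite -[1]mul1r ler_pM.
Qed.

(** This is the conditional expectation of [h] on the partition, with value 0 on null cells by the
    convention [0^-1 = 0]. *)
Definition cell_avg (h : J -> R) (x : J) : R :=
  \sum_i \1_(V i) x * ((fine (mu (V i)))^-1 * \int[mu]_y (\1_(V i) y * h y)).

Section CellAvg.
Variable h : J -> R.
Hypotheses (bh : bounded_measurable h) (h01 : forall x, 0 <= h x <= 1).

Lemma bm_cell_avg : bounded_measurable (cell_avg h).
Proof. by have bV := bm_cell; rewrite /cell_avg; bm. Qed.

Lemma cell_int_ge0 i : 0 <= \int[mu]_y (\1_(V i) y * h y).
Proof.
apply: Rintegral_ge0 => y _; rewrite mulr_ge0 ?indicE//.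
by have /andP[] := h01 y.
Qed.

Lemma cell_int_le i : \int[mu]_y (\1_(V i) y * h y) <= fine (mu (V i)).
Proof.
have bV := bm_cell; have [mV _ _] := pV.
rewrite -Rintegral_indic//; apply: bm_le_int; [by bm|by bm|] => y.
by rewrite -[leRHS]mulr1 ler_wpM2l ?indicE//; have /andP[] := h01 y.
Qed.

Lemma cell_avg01 x : 0 <= cell_avg h x <= 1.
Proof.
have [i ix] := partition_ex x; rewrite /cell_avg.
rewrite (partition_sum (fun i => _ * \int[mu]_y (\1_(V i) y * h y)) ix).
have := cell_int_ge0 i; have := cell_int_le i.
have : 0 <= fine (mu (V i)) by apply: fine_ge0.
rewrite le_eqVlt => /orP[/eqP <-|m0 hle hge].
  by rewrite invr0 mul0r lexx ler01.
by rewrite mulr_ge0 ?invr_ge0 ?(ltW m0)//= mulrC ler_pdivrMr// mul1r.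
Qed.

Lemma cell_avg_orth i : \int[mu]_x (\1_(V i) x * (h x - cell_avg h x)) = 0.
Proof.
have bV := bm_cell; have ba := bm_cell_avg; have [mV _ _] := pV.
set q := \int[mu]_y (\1_(V i) y * h y).
transitivity (\int[mu]_x
    (\1_(V i) x * h x - \1_(V i) x * ((fine (mu (V i)))^-1 * q))).
  apply: eq_Rintegral => x _; rewrite mulrBr; congr (_ - _).
  rewrite [\1_(V i) x]indicE; have [|] := boolP (x \in V i); last by rewrite !mul0r.
  rewrite inE => ix; congr (_ * _); rewrite /cell_avg.
  exact: (partition_sum (fun i => (fine (mu (V i)))^-1 * _) ix).
rewrite bm_intB; [|by bm|by bm].
rewrite bm_intZr; last by bm.
rewrite Rintegral_indic// -/q mulrA.
have := cell_int_ge0 i; have := cell_int_le i; rewrite -/q.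
(* On a null cell the bounds [0 <= q <= 0] force [q = 0], so the division by zero does no harm. *)
have [->|m0 _ _] := eqVneq (fine (mu (V i))) 0.
  by move=> q1 q2; rewrite !mul0r subr0; apply/eqP; rewrite eq_le q1 q2.
by rewrite divff// mul1r subrr.
Qed.

End CellAvg.

(** Averaging over cells is self-adjoint in each variable: both sides expand to the same sum over
    pairs of cells, whose terms multiply the cell integrals of [f], [h] and [W] by the inverse
    measures. *)
Lemma int_stepping (f h : J -> R) :
  bounded_measurable f -> bounded_measurable h ->
  \int[mu]_x \int[mu]_y (f x * h y * stepping mu W V x y) =
  \int[mu]_x \int[mu]_y (cell_avg f x * cell_avg h y * W x y).
Proof.
move=> bf bh; have bV := bm_cell.
have int_sum2 (F : I -> I -> J -> J -> R) : (forall i j, bm2 (F i j)) ->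
    \int[mu]_x \int[mu]_y (\sum_i \sum_j F i j x y) =
    \sum_i \sum_j \int[mu]_x \int[mu]_y F i j x y.
  move=> bF.
  have bFi i j : bounded_measurable (fun x => \int[mu]_y F i j x y).
    exact: bm_param_int.
  have bFx i j x : bounded_measurable (F i j x).
    by have bij := bF i j; bm.
  under eq_bigr => i _ do rewrite -bm_int_sum//.
  rewrite -bm_int_sum; last by move=> i; exact: bm_sum.
  apply: eq_Rintegral => x _.
  rewrite bm_int_sum; last by move=> i; exact: bm_sum.
  by apply: eq_bigr => i _; rewrite bm_int_sum.
transitivity (\int[mu]_x \int[mu]_y \sum_i \sum_j
    (\1_(V i) x * f x * (\1_(V j) y * h y * step_coef i j))).
  apply: eq_Rintegral => x _; apply: eq_Rintegral => y _; rewrite steppingE//.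
  rewrite mulr_sumr; apply: eq_bigr => i _.
  by rewrite !mulr_sumr; apply: eq_bigr => j _; ring.
rewrite int_sum2; last by move=> i j; bm.
transitivity (\int[mu]_x \int[mu]_y \sum_i \sum_j
   ((fine (mu (V i)))^-1 * (\int[mu]_x (\1_(V i) x * f x)) *
    ((fine (mu (V j)))^-1 * (\int[mu]_y (\1_(V j) y * h y))) *
    (\1_(V i) x * \1_(V j) y * W x y))); last first.
  apply: eq_Rintegral => x _; apply: eq_Rintegral => y _; rewrite /cell_avg.
  rewrite !mulr_suml; apply: eq_bigr => i _.
  by rewrite mulr_sumr mulr_suml; apply: eq_bigr => j _; ring.
rewrite int_sum2; last by move=> i j; bm.
apply: eq_bigr => i _; apply: eq_bigr => j _.
transitivity ((\int[mu]_x (\1_(V i) x * f x)) *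
   ((\int[mu]_y (\1_(V j) y * h y)) * step_coef i j)).
  rewrite -bm_intZr; last by bm.
  apply: eq_Rintegral => x _; rewrite bm_intZl; last by bm.
  by rewrite bm_intZr//; bm.
rewrite /step_coef invfM.
pose p := \int[mu]_x \int[mu]_y (\1_(V i) x * \1_(V j) y * W x y).
pose c := (fine (mu (V i)))^-1 * (\int[mu]_x (\1_(V i) x * f x)) *
    ((fine (mu (V j)))^-1 * (\int[mu]_y (\1_(V j) y * h y))).
rewrite -/p -/c.
transitivity (c * p); first by rewrite /c; ring.
rewrite /p -bm_intZl; last by bm.
by apply: eq_Rintegral => x _; rewrite bm_intZl//; bm.
Qed.

End Partition.

End Graphon.

(** * Sign sets, moments and means of real functions *)

Lemma indic_gt0 (R : realType) (T : Type) (u : T -> R) x :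
  \1_(u @^-1` `]0, +oo[) x = (0 < u x)%R%:R :> R.
Proof.
rewrite indicE; congr ((nat_of_bool _)%:R).
by apply/idP/idP; rewrite inE /= in_itv /= andbT.
Qed.

Lemma indic_lt0 (R : realType) (T : Type) (u : T -> R) x :
  \1_(u @^-1` `]-oo, 0[) x = (u x < 0)%R%:R :> R.
Proof.
rewrite indicE; congr ((nat_of_bool _)%:R).
by apply/idP/idP; rewrite inE /= in_itv.
Qed.

Section RealInt.
Context (R : realType) d (T : measurableType d) (mu : probability T R).
Implicit Types f u : T -> R.

(* AM-GM: [2 s |u| <= u ^ 2 + s ^ 2] for [s = sqrt e] *)
Lemma int_norm_le_sqrt u (e : R) : bounded_measurable u -> 0 < e ->
  \int[mu]_x (u x) ^+ 2 <= e -> \int[mu]_x `|u x| <= Num.sqrt e.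
Proof.
move=> bu e0 ue; set s := Num.sqrt e.
have s0 : 0 < s by rewrite sqrtr_gt0.
have s2 : s ^+ 2 = e by rewrite sqr_sqrtr// ltW.
have : \int[mu]_x (2 * s * `|u x|) <= \int[mu]_x (u x ^+ 2 + e).
  apply: bm_le_int; [by bm|by bm|] => x.
  by rewrite -s2 -(real_normK (num_real (u x))); have := sqr_ge0 (`|u x| - s); nra.
rewrite bm_intZl; last by bm.
rewrite bm_intD; [|by bm|by bm].
rewrite RintegralT_cst -s2 => h; rewrite -(ler_pM2l s0).
move: ue; rewrite -s2; nra.
Qed.

(** If every point of [A] failed, [g] below would be nonnegative with integral 0, yet positive on
    all of [A], so that [A] would be null. *)
Lemma exists_le_avg f (A : set T) : bounded_measurable f -> measurable A ->
  (0 < mu A)%E ->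
  exists2 x, A x & f x * fine (mu A) <= \int[mu]_y (\1_A y * f y).
Proof.
move=> bf mA A0; apply: contrapT => hn.
set q := \int[mu]_y (\1_A y * f y) in hn; set m := fine (mu A) in hn.
have hlt x : A x -> q < f x * m.
  by move=> Ax; rewrite ltNge; apply/negP => h; apply: hn; exists x.
have bA := bm_indic R mA.
pose g x := \1_A x * (f x * m - q).
have bg : bounded_measurable g by rewrite /g; bm.
have g0 : \int[mu]_x g x = 0.
  transitivity (\int[mu]_x (\1_A x * f x * m - \1_A x * q)).
    by apply: eq_Rintegral => x _; rewrite /g; ring.
  rewrite bm_intB; [|by bm|by bm].
  rewrite bm_intZr; last by bm.
  rewrite bm_intZr; last by bm.
  by rewrite Rintegral_indic// -/q -/m; ring.
have gge x : 0 <= g x.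
  rewrite /g indicE; have [|] := boolP (x \in A); last by rewrite mul0r.
  by rewrite inE => /hlt h; rewrite mul1r subr_ge0 ltW.
have mg : measurable_fun setT (EFin \o g) by apply/measurable_EFinP; case: bg.
have : (\int[mu]_x `|(EFin \o g) x| = 0)%E.
  under eq_integral => x _ do rewrite /= ger0_norm//.
  by rewrite bm_integralE// g0.
move=> /(ae_eq_integral_abs mu measurableT mg) [N [mN N0 sub]].
have AN : A `<=` N.
  move=> x Ax; apply: sub => /= /(_ I) [].
  rewrite /g indicE mem_set// mul1r => /eqP; rewrite subr_eq0 => /eqP h.
  by have := hlt x Ax; rewrite h ltxx.
have : (mu A <= mu N)%E by apply: le_measure => //; rewrite inE.
by rewrite N0 leNgt A0.
Qed.

End RealInt.

(** * Distance to a finite set of centers *)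

Section DistTo.
Context (R : realType) d (J : measurableType d) (r : J -> J -> R).

Lemma dist_to_le (S : {fset J}) x s : s \in S -> (dist_to r S x <= (r x s)%:E)%E.
Proof.
rewrite /dist_to => sS; have {sS} : s \in enum_fset S by [].
elim: (enum_fset S) => [//|t l ih].
rewrite inE big_cons ge_min => /orP[/eqP->|/ih ->]; first by rewrite lexx.
by rewrite orbT.
Qed.

Lemma dist_to_ge (S : {fset J}) x c :
  (forall s, s \in S -> c <= r x s) -> (c%:E <= dist_to r S x)%E.
Proof.
move=> h; rewrite /dist_to.
have {h}: forall s, s \in enum_fset S -> c <= r x s by move=> s; exact: h.
elim: (enum_fset S) => [|t l ih] h; first by rewrite big_nil leey.
rewrite big_cons le_min lee_fin h ?mem_head//= ih// => s sl.
by rewrite h// inE sl orbT.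
Qed.

Lemma measurable_dist_to (S : {fset J}) :
  bounded_measurable (fun z : J * J => r z.1 z.2) ->
  measurable_fun [set: J] (dist_to r S).
Proof.
move=> br; rewrite /dist_to; elim: (enum_fset S) => [|t l ih].
  by under eq_fun do rewrite big_nil; exact: measurable_cst.
under eq_fun do rewrite big_cons.
apply: measurable_mine => //; apply/measurable_EFinP.
by have [] : bounded_measurable (fun x => r x t) by bm.
Qed.

End DistTo.

(** * The cut norm *)

Section CutNorm.
Context (R : realType) d (J : measurableType d) (mu : probability J R).
Variable (U : J -> J -> R).
Hypothesis bU : bounded_measurable (fun z : J * J => U z.1 z.2).

(** This trades the extended-real supremum for a real bound, uniform over rectangles, on iterated
    integrals. *)
Lemma cut_norm_leP (c : R) : (cut_norm mu U <= c%:E)%E <->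
  forall A B, measurable A -> measurable B ->
    `|\int[mu]_x \int[mu]_y (\1_A x * \1_B y * U x y)| <= c.
Proof.
split=> [h A B mA mB|h].
  rewrite -lee_fin; apply: le_trans h; apply: ereal_sup_ubound.
  by exists A, B; split => //; rewrite bm_int_rect.
apply: ge_ereal_sup => _ [A [B [mA mB ->]]].
by rewrite bm_int_rect// lee_fin h.
Qed.

Variable c : R.
Hypothesis Uc : forall A B, measurable A -> measurable B ->
    `|\int[mu]_x \int[mu]_y (\1_A x * \1_B y * U x y)| <= c.

(* The integral of [h u] over [0 <= h <= 1] is extremal at [h = 1_{u > 0}]
   and at [h = 1_{u < 0}]. *)
Lemma cut_int_fun (A : set J) (h : J -> R) : measurable A ->
  bounded_measurable h -> (forall x, 0 <= h x <= 1) ->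
  `|\int[mu]_x (\1_A x * \int[mu]_y (U x y * h y))| <= c.
Proof.
move=> mA bh h01; have bA := bm_indic R mA.
(* Integrating over [A] first leaves a function of [y] alone, against which [h] enters linearly. *)
pose u y := \int[mu]_x (\1_A x * U x y).
have bu : bounded_measurable u.
  by apply: (@bm_param_int _ _ _ _ _ mu (fun y x => \1_A x * U x y)); bm.
have -> : \int[mu]_x (\1_A x * \int[mu]_y (U x y * h y)) =
          \int[mu]_y (h y * u y).
  transitivity (\int[mu]_x \int[mu]_y (\1_A x * U x y * h y)).
    apply: eq_Rintegral => x _; rewrite -bm_intZl; last by bm.
    by apply: eq_Rintegral => y _; ring.
  rewrite bm_Fubini; last by bm.
  by apply: eq_Rintegral => y _; rewrite bm_intZr 1?mulrC//; bm.
have uB B : measurable B -> `|\int[mu]_y (\1_B y * u y)| <= c.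
  move=> mB; have bB := bm_indic R mB.
  have -> : \int[mu]_y (\1_B y * u y) =
            \int[mu]_x \int[mu]_y (\1_A x * \1_B y * U x y).
    rewrite bm_Fubini; last by bm.
    apply: eq_Rintegral => y _; rewrite -bm_intZl; last by bm.
    by apply: eq_Rintegral => x _; ring.
  exact: Uc.
have mP : measurable (u @^-1` `]0, +oo[).
  by rewrite -[_ @^-1` _]setTI; apply: bu.1.
have mN : measurable (u @^-1` `]-oo, 0[).
  by rewrite -[_ @^-1` _]setTI; apply: bu.1.
have bP := bm_indic R mP; have bN := bm_indic R mN.
have := uB _ mP; have := uB _ mN.
rewrite !ler_norml => /andP[hN _] /andP[_ hP].
apply/andP; split.
  apply: le_trans hN _; apply: bm_le_int; [by bm|by bm|] => y.
  rewrite indic_lt0; have /andP[h0 h1] := h01 y.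
  by case: ltP => u0 /=; rewrite ?mul1r ?mul0r; nra.
apply: le_trans hP; apply: bm_le_int; [by bm|by bm|] => y.
rewrite indic_gt0; have /andP[h0 h1] := h01 y.
by case: ltP => u0 /=; rewrite ?mul1r ?mul0r; nra.
Qed.

(** The norm is the integral of [u] over its positivity set minus that over its negativity set.
    [cut_int_fun] bounds each by [c], whence the factor 2. *)
Lemma cut_int_norm (h : J -> R) :
  bounded_measurable h -> (forall x, 0 <= h x <= 1) ->
  \int[mu]_x `|\int[mu]_y (U x y * h y)| <= 2 * c.
Proof.
move=> bh h01; pose u x := \int[mu]_y (U x y * h y).
have bu : bounded_measurable u by rewrite /u; bm.
have mP : measurable (u @^-1` `]0, +oo[).
  by rewrite -[_ @^-1` _]setTI; apply: bu.1.
have mN : measurable (u @^-1` `]-oo, 0[).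
  by rewrite -[_ @^-1` _]setTI; apply: bu.1.
have bP := bm_indic R mP; have bN := bm_indic R mN.
have := cut_int_fun mP bh h01; have := cut_int_fun mN bh h01.
rewrite -/(u _) !ler_norml => /andP[hN _] /andP[_ hP].
have -> : \int[mu]_x `|u x| =
    \int[mu]_x (\1_(u @^-1` `]0, +oo[) x * u x - \1_(u @^-1` `]-oo, 0[) x * u x).
  apply: eq_Rintegral => x _; rewrite indic_gt0 indic_lt0.
  have [u0|u0|u0] := ltgtP 0 (u x).
  - by rewrite gtr0_norm//= mul1r mul0r subr0.
  - by rewrite ltr0_norm//= mul1r mul0r sub0r.
  - by rewrite -u0 normr0 !mulr0 subrr.
rewrite bm_intB; [|by bm|by bm].
by rewrite mulr_natl mulr2n lerD// lerNl.
Qed.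

End CutNorm.

(** * Nets and regularity partitions *)

Section CenterSelection.
Context (R : realType) d (J : measurableType d) (mu : probability J R).
Context (I : finType) (V : I -> set J).
Hypothesis pV : measurable_partition V.

(** The factor 2 counts [F] at the point and [F] at its center. The latter integrates to at most the
    integral of [F], because each center is chosen with [F] no larger than its mean over the
    class. *)
Lemma exists_centers (r : J -> J -> R) (F : J -> R) :
  bounded_measurable (fun z : J * J => r z.1 z.2) -> bounded_measurable F ->
  (forall i a b, V i a -> V i b -> r a b <= F a + F b) ->
  (forall i, (0 < mu (V i))%E) ->
  exists v : I -> J, (forall i, V i (v i)) /\
    \int[mu]_x \sum_i \1_(V i) x * r x (v i) <= 2 * \int[mu]_x F x.
Proof.
move=> br bF rF V0; have [mV _ _] := pV; have bV := bm_cell R pV.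
have /choice[v hv] : forall i, exists x, V i x /\
    F x * fine (mu (V i)) <= \int[mu]_y (\1_(V i) y * F y).
  by move=> i; have [x ? ?] := exists_le_avg bF (mV i) (V0 i); exists x.
exists v; split=> [i|]; first by case: (hv i).
apply: (@le_trans _ _ (\int[mu]_x
    (\sum_i \1_(V i) x * F x + \sum_i \1_(V i) x * F (v i)))).
  apply: bm_le_int; [by bm|by bm|] => x; have [i ix] := partition_ex pV x.
  rewrite (partition_sum pV (fun i => r x (v i)) ix).
  rewrite (partition_sum pV (fun=> F x) ix).
  rewrite (partition_sum pV (fun i => F (v i)) ix).
  by apply: rF ix _; case: (hv i).
have sumF : \int[mu]_x \sum_i \1_(V i) x * F x = \int[mu]_x F x.
  apply: eq_Rintegral => x _; have [i ix] := partition_ex pV x.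
  by rewrite (partition_sum pV (fun=> F x) ix).
have sumv : \int[mu]_x \sum_i \1_(V i) x * F (v i) <= \int[mu]_x F x.
  rewrite -sumF !bm_int_sum; [|by move=> i; bm|by move=> i; bm].
  apply: ler_sum => i _; rewrite bm_intZr; last by bm.
  by rewrite Rintegral_indic// mulrC; case: (hv i).
rewrite bm_intD; [|by bm|by bm].
by rewrite sumF; lra.
Qed.

End CenterSelection.

Section NetPartition.
Context (R : realType) d (J : measurableType d) (mu : probability J R).
Variable W : J -> J -> R.
Hypothesis bW : bounded_measurable (fun z : J * J => W z.1 z.2).
Hypothesis symW : forall x y, W x y = W y x.
Hypothesis W01 : forall x y, 0 <= W x y <= 1.
Context (I : finType) (V : I -> set J).
Hypothesis pV : measurable_partition V.

Let bS := bm_stepping mu bW pV.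

Lemma cut_stepping_le_sqrt (s : I -> J) (eps : R) (f h : J -> R) : 0 < eps ->
  \int[mu]_x \sum_i \1_(V i) x * similarity_dist mu W x (s i) <= eps ->
  bounded_measurable f -> (forall x, 0 <= f x <= 1) ->
  bounded_measurable h -> (forall x, 0 <= h x <= 1) ->
  `|\int[mu]_x \int[mu]_y (f x * h y * (W x y - stepping mu W V x y))| <=
    2 * Num.sqrt eps.
Proof.
move=> eps0 net bf f01 bh h01.
have bV := bm_cell R pV.
have int_le g : bounded_measurable g -> (forall x, 0 <= g x <= 1) ->
    \int[mu]_z `|\int[mu]_x (W z x * (g x - cell_avg mu V g x))| <= Num.sqrt eps.
  move=> bg g01; have ba := bm_cell_avg mu pV g.
  apply: int_norm_le_sqrt => //; first by bm.
  apply: le_trans net; apply: int_sqr_le_dist => //.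
  - by bm.
  - move=> x; have /andP[? ?] := g01 x.
    by have /andP[? ?] := cell_avg01 mu pV bg g01 x; rewrite ler_norml; lra.
  - by move=> i; exact: cell_avg_orth.
have baf := bm_cell_avg mu pV f; have bah := bm_cell_avg mu pV h.
set fV := cell_avg mu V f in baf *; set hV := cell_avg mu V h in bah *.
(* By [int_stepping] the averaging moves from [W] to [f] and [h]; then
   [f h - fV hV = f (h - hV) + hV (f - fV)] splits the integral into two terms, each controlled by
   [int_le]. *)
have -> : \int[mu]_x \int[mu]_y (f x * h y * (W x y - stepping mu W V x y)) =
    \int[mu]_x (f x * \int[mu]_y (W x y * (h y - hV y))) +
    \int[mu]_y (hV y * \int[mu]_x (W y x * (f x - fV x))).
  transitivity (\int[mu]_x \int[mu]_y (f x * h y * W x y) -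
                \int[mu]_x \int[mu]_y (fV x * hV y * W x y)).
    rewrite -(int_stepping mu bW pV bf bh) -bm_intB; [|by bm|by bm].
    apply: eq_Rintegral => x _; rewrite -bm_intB; [|by bm|by bm].
    by apply: eq_Rintegral => y _; ring.
  have swap : \int[mu]_y (hV y * \int[mu]_x (W y x * (f x - fV x))) =
      \int[mu]_x \int[mu]_y (hV y * W x y * (f x - fV x)).
    rewrite [RHS]bm_Fubini; last by bm.
    apply: eq_Rintegral => y _; rewrite -bm_intZl; last by bm.
    by apply: eq_Rintegral => x _; rewrite (symW y x); ring.
  rewrite [X in _ = _ + X]swap -bm_intB; [|by bm|by bm].
  rewrite -bm_intD; [|by bm|by bm].
  apply: eq_Rintegral => x _.
  rewrite -bm_intZl; last by bm.
  rewrite -bm_intB; [|by bm|by bm].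
  rewrite -bm_intD; [|by bm|by bm].
  by apply: eq_Rintegral => y _; ring.
have int_mul_le (k u : J -> R) : bounded_measurable k ->
    (forall x, 0 <= k x <= 1) -> bounded_measurable u ->
    `|\int[mu]_x (k x * u x)| <= \int[mu]_x `|u x|.
  move=> bk k01 bu; apply: le_trans (bm_le_norm_int _ _) _; first by bm.
  apply: bm_le_int; [by bm|by bm|] => x; have /andP[? ?] := k01 x.
  by rewrite normrM ger0_norm// -[leRHS]mul1r ler_wpM2r.
rewrite mulr_natl mulr2n (le_trans (ler_normD _ _))// lerD//.
  by apply: le_trans (int_le h bh h01); apply: int_mul_le => //; bm.
apply: le_trans (int_le f bf f01); apply: int_mul_le => //; last by bm.
exact: cell_avg01.
Qed.

Section Defect.

Let U x y := W x y - stepping mu W V x y.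
Let defect a := \int[mu]_x `|\int[mu]_y (U a y * W y x)|.

Let bU : bounded_measurable (fun z : J * J => U z.1 z.2).
Proof. by rewrite /U; bm. Qed.

(* [stepping mu W V a y] only depends on the class of [a], so that
   [(W \o W) a - (W \o W) b] is unchanged when [W] is replaced by [U] in the
   first factor. *)
Lemma similarity_dist_le_defect i a b : V i a -> V i b ->
  similarity_dist mu W a b <= defect a + defect b.
Proof.
move=> ia ib; have bK := bm_graphon_comp mu bW.
rewrite /defect -bm_intD; [|by bm|by bm].
apply: bm_le_int; [by bm|by bm|] => x.
rewrite (_ : graphon_comp mu W a x - graphon_comp mu W b x =
  \int[mu]_y (U a y * W y x) - \int[mu]_y (U b y * W y x)).
  exact: ler_normB.
rewrite /graphon_comp -bm_intB; [|by bm|by bm].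
rewrite -bm_intB; [|by bm|by bm].
apply: eq_Rintegral => y _; rewrite /U !steppingE//.
rewrite (partition_sum pV (fun i => \sum_j _) ia).
rewrite (partition_sum pV (fun i => \sum_j _) ib).
by ring.
Qed.

(** After exchanging the integrals, for fixed [x] the column of [W] at [x] is a test function with
    values in [0, 1], so [cut_int_norm] applies; the bound is then averaged over [x]. *)
Lemma int_defect_le (c : R) : (cut_norm mu U <= c%:E)%E ->
  \int[mu]_a defect a <= 2 * c.
Proof.
move=> /(cut_norm_leP mu bU) hc; rewrite /defect.
rewrite bm_Fubini; last by bm.
rewrite -[leRHS](RintegralT_cst mu); apply: bm_le_int; [by bm|by bm|] => x.
by apply: (cut_int_norm bU hc) => //; bm.
Qed.

(** The constant 4 is the product of the factor 2 of [exists_centers] and the factor 2 of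
    [int_defect_le]. *)
Lemma exists_average_net (c : R) : (cut_norm mu U <= c%:E)%E ->
  (forall i, (0 < mu (V i))%E) ->
  exists v : I -> J, (forall i, V i (v i)) /\
    \int[mu]_x \sum_i \1_(V i) x * similarity_dist mu W x (v i) <= 4 * c.
Proof.
move=> hc V0; have br := bm_similarity_dist mu bW.
have bF : bounded_measurable defect by rewrite /defect; bm.
have [v [Vv hv]] := exists_centers pV br bF similarity_dist_le_defect V0.
exists v; split=> //; apply: le_trans hv _.
by have := int_defect_le hc; lra.
Qed.

End Defect.

End NetPartition.

Theorem theorem5p3 (R : realType) (d : measure_display) (J : measurableType d)
    (mu : probability J R) (W : J -> J -> R) (eps : R) :
  graphon mu W -> 0 < eps ->
  (forall (S : {fset J}) (V : S -> set J),
      average_net mu (similarity_dist mu W) eps S ->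
      voronoi_partition (similarity_dist mu W) V ->
      weak_regularity_partition mu W (8 * Num.sqrt eps) V) /\
  (forall (k : nat) (P : 'I_k -> set J),
      weak_regularity_partition mu W eps P ->
      (forall i, (0 < mu (P i))%E) ->
      exists v : 'I_k -> J,
        (forall i, P i (v i)) /\
        average_net mu (similarity_dist mu W) (4 * eps)
          [fset v i | i : 'I_k]%fset).
Proof.
move=> [_ mW symW W01] eps0.
have bW : bounded_measurable (fun z : J * J => W z.1 z.2).
  split => //; exists 1 => z.
  by have /andP[? ?] := W01 z.1 z.2; rewrite ger0_norm.
have br := bm_similarity_dist mu bW.
have r0 x y : 0 <= similarity_dist mu W x y by apply: Rintegral_ge0.
have dist0 S x : (0 <= dist_to (similarity_dist mu W) S x)%E.
  by apply: dist_to_ge.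
split=> [S V net [pV cells]|k P [pP cutP] P0].
  have bV := bm_cell R pV; have bS := bm_stepping mu bW pV.
  split=> //; apply/cut_norm_leP; first by bm.
  move=> A B mA mB.
  (* The sharper constant 2 is what [cut_stepping_le_sqrt] yields. *)
  apply: (@le_trans _ _ (2 * Num.sqrt eps)); last first.
    by rewrite ler_wpM2r ?sqrtr_ge0// ler_nat.
  have indic01 (D : set J) x : 0 <= (\1_D x : R) <= 1.
    by rewrite indicE ler0n lern1 leq_b1.
  apply: (cut_stepping_le_sqrt (mu := mu) bW symW pV (s := fun i => val i)
    (f := \1_A) (h := \1_B)) => //.
  - rewrite -lee_fin -bm_integralE; last by bm.
    apply: le_trans net; apply: ge0_le_integral => //.
    + move=> x _; rewrite lee_fin sumr_ge0// => i _.
      by rewrite mulr_ge0// indicE.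
    + by apply/measurable_EFinP; have [] : bounded_measurable (fun x =>
        \sum_i \1_(V i) x * similarity_dist mu W x (val i)) by bm.
    + exact: measurable_dist_to.
    (* A point of a Voronoi cell is at least as close to the center of that cell as to any other, so
       this distance is at most the minimum [dist_to]. *)
    + move=> x _; have [i ix] := partition_ex pV x.
      rewrite (partition_sum pV (fun i => similarity_dist mu W x (val i)) ix).
      by apply: dist_to_ge => s sS; exact: (cells i x ix).
  - exact: bm_indic.
  - exact: bm_indic.
have [v [Pv hv]] := exists_average_net (mu := mu) bW W01 pP cutP P0.
have bV := bm_cell R pP.
exists v; split => //; rewrite /average_net.
apply: le_trans (_ : (_ <= (\int[mu]_x \sum_i \1_(P i) x *
  similarity_dist mu W x (v i))%:E)%E) _; last by rewrite lee_fin.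
rewrite -bm_integralE; last by bm.
apply: ge0_le_integral => //.
- exact: measurable_dist_to.
- by apply/measurable_EFinP; have [] : bounded_measurable (fun x =>
    \sum_i \1_(P i) x * similarity_dist mu W x (v i)) by bm.
(* Here only the easy inequality is needed: the chosen point of the class of [x] is one of the
   candidates in the minimum. *)
- move=> x _; have [i ix] := partition_ex pP x.
  rewrite (partition_sum pP (fun i => similarity_dist mu W x (v i)) ix).
  by apply: dist_to_le; apply/imfsetP; exists i.
Qed.
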